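(* Let $1\le p'\le p$ and let $L$ be a real-valued Lévy process with Lévy measure $\nu$ satisfying $\int_{|z|>1}|z|^p\nu(dz)<\infty$. For any $\gamma>0$ and $\kappa>0$ such that $\gamma^2-4\kappa<0$, the linear oscillator $$dX^\varepsilon_t=Y^\varepsilon_t\,dt,\qquad dY^\varepsilon_t=-\kappa X^\varepsilon_t\,dt-\gamma Y^\varepsilon_t\,dt+\varepsilon\,dL_t,\qquad (X^\varepsilon_0,Y^\varepsilon_0)=(x,y),$$ has no cutoff thermalization profile (with respect to $\mathcal{W}_{p'}$) for any initial value $(x,y)\ne(0,0)$.
   Context: $L$ has stationary independent increments, $L_0=0$, càdlàg paths. Write $Z^\varepsilon_t(z)=(X^\varepsilon_t,Y^\varepsilon_t)^*$, $z=(x,y)^*$, which solves $dZ^\varepsilon_t=-\mathcal{Q}Z^\varepsilon_t\,dt+\varepsilon\,d\mathcal{L}_t$ with $$\mathcal{Q}=\begin{pmatrix}0&-1\\\kappa&\gamma\end{pmatrix},\qquad\mathcal{L}_t=\begin{pmatrix}0\\L_t\end{pmatrix}.$$ For $\gamma,\kappa>0$ all eigenvalues of $\mathcal{Q}$ have positive real part; in the case $\gamma^2<4\kappa$ they are $\frac\gamma2\pm i\frac{\sqrt{4\kappa-\gamma^2}}2$. $\mu^\varepsilon$ denotes the unique limiting distribution of $Z^\varepsilon_t(z)$ as $t\to\infty$. For laws $\mu_1,\mu_2$ on $\mathbb{R}^2$ with finite $p'$-th moments, $p'\ge1$, $\mathcal{W}_{p'}(\mu_1,\mu_2)=\inf_\Pi\big(\int|u-v|^{p'}\,\Pi(du,dv)\big)^{1/p'}$,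 the infimum over all couplings $\Pi$; random variables as arguments stand for their laws. Cutoff thermalization profile (case $\gamma^2<4\kappa$). Let $\mathfrak{t}_\varepsilon=\frac2\gamma|\ln(\varepsilon)|$ and let $\omega(z)$ be the set of accumulation points of $e^{\frac\gamma2t}e^{-\mathcal{Q}t}z$ as $t\to\infty$. The system has a cutoff thermalization profile for the initial value $z\neq 0$ if for all window sizes $w_\varepsilon\to w>0$ (as $\varepsilon\to0$) and every $r\in\mathbb{R}$ the limit $$\lim_{\varepsilon\to0}\frac{\mathcal{W}_{p'}(Z^\varepsilon_{\mathfrak{t}_\varepsilon+r\cdot w_\varepsilon}(z),\mu^\varepsilon)}{\varepsilon}$$ exists and equals $e^{-r\frac\gamma2w}|v|$ for any representative $v\in\omega(z)$. *)

(* Defs.v *)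
From HB Require Import structures.
From mathcomp Require Import all_boot all_order all_algebra.
From mathcomp Require Import all_classical all_reals all_analysis.
Set Implicit Arguments.
Unset Strict Implicit.
Unset Printing Implicit Defensive.
Import Order.TTheory GRing.Theory Num.Theory.
Import numFieldNormedType.Exports.
Local Open Scope classical_set_scope.
Local Open Scope ring_scope.

(* Time is the half-line [0, +oo[ inside R: a process is indexed by all of R,
   and its values at negative times are unconstrained and irrelevant. *)

Definition cadlag (R : realType) (f : R -> R) : Prop :=
  (forall t, 0 <= t -> f s @[s --> t^'+] --> f t) /\
  (forall t, 0 < t -> cvg (f s @[s --> t^'-])).

Definition levy_process (R : realType) (d : measure_display)
    (Omega : measurableType d) (P : probability Omega R)
    (L : R -> {RV P >-> R}) : Prop :=
  [/\ {ae P, forall w, L 0 w = 0},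
      {ae P, forall w, cadlag (fun t => L t w)},
      forall (s t : R) (B : set R), 0 <= s -> 0 <= t -> measurable B ->
        P [set w | B (L (s + t) w - L s w)] = P [set w | B (L t w)] &
      forall (n : nat) (t : nat -> R) (B : nat -> set R),
        0 <= t 0%N -> (forall i j, (i <= j)%N -> t i <= t j) ->
        (forall i, measurable (B i)) ->
        P [set w | forall i, (i < n)%N -> B i (L (t i.+1) w - L (t i) w)] =
        (\prod_(i < n) P [set w | B i (L (t i.+1) w - L (t i) w)%R])%E].

(* Real and imaginary parts of the Levy-Khintchine exponent
   psi u = i b u - s2 u^2 / 2
           + \int (e^{i u z} - 1 - i u z 1_{|z| <= 1}) nu(dz). *)
Definition levy_exponent_re (R : realType) (s2 : R)
    (nu : {measure set R -> \bar R}) (u : R) : R :=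
  - (s2 * u ^+ 2 / 2) + \int[nu]_z (cos (u * z) - 1).

Definition levy_exponent_im (R : realType) (b : R)
    (nu : {measure set R -> \bar R}) (u : R) : R :=
  b * u + \int[nu]_z (sin (u * z) - u * z * \1_[set z : R | `|z| <= 1] z).

(* nu is the Levy measure of L: the measure of its characteristic triplet
   (b, s2, nu), with E[e^{i u L_t}] = e^{t psi u} split into real and
   imaginary parts. *)
Definition levy_measure_of (R : realType) (d : measure_display)
    (Omega : measurableType d) (P : probability Omega R)
    (L : R -> {RV P >-> R}) (nu : {measure set R -> \bar R}) : Prop :=
  [/\ nu [set 0] = 0%E,
      (\int[nu]_z (Num.min 1 (z ^+ 2))%R%:E < +oo)%E &
      exists b s2 : R, 0 <= s2 /\
        forall t u : R, 0 <= t ->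
          \int[P]_w cos (u * L t w) =
            expR (t * levy_exponent_re s2 nu u)
            * cos (t * levy_exponent_im b nu u) /\
          \int[P]_w sin (u * L t w) =
            expR (t * levy_exponent_re s2 nu u)
            * sin (t * levy_exponent_im b nu u)].

(* Since the noise is additive, the equation is the pathwise integral equation
   X_t = x + \int_0^t Y_s ds,
   Y_t = y - \int_0^t (kappa X_s + gamma Y_s) ds + eps L_t. *)
Definition oscillator_solution (R : realType) (d : measure_display)
    (Omega : measurableType d) (P : probability Omega R)
    (L : R -> {RV P >-> R}) (gamma kappa eps : R) (z : R * R)
    (Z : R -> {RV P >-> (R * R)%type}) : Prop :=
  {ae P, forall w,
    [/\ cadlag (fun t => (Z t w).1), cadlag (fun t => (Z t w).2) &
        forall t : R, 0 <= t ->
          (Z t w).1 = z.1 + \int[lebesgue_measure]_(s in `[0, t]) (Z s w).2 /\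
          (Z t w).2 = z.2
            + \int[lebesgue_measure]_(s in `[0, t])
                (- kappa * (Z s w).1 - gamma * (Z s w).2)
            + eps * L t w]}.

Definition limiting_distribution (R : realType) (d : measure_display)
    (Omega : measurableType d) (P : probability Omega R)
    (Z : R -> {RV P >-> (R * R)%type}) (mu : probability (R * R)%type R)
    : Prop :=
  forall f : R * R -> R, continuous f -> [bounded f u | u in [set: R * R]] ->
    (\int[distribution P (Z t)]_u (f u)%:E)%E @[t --> +oo] -->
    (\int[mu]_u (f u)%:E)%E.

Definition colv (R : realType) (z : R * R) : 'cV[R]_2 :=
  \col_(i < 2) if i == 0 then z.1 else z.2.

(* The library norm on matrices and on pairs is the max norm. *)
Definition euclid (R : realType) (v : 'cV[R]_2) : R :=
  Num.sqrt (\sum_(i < 2) v i 0 ^+ 2).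

Definition couplings (R : realType) (mu1 mu2 : probability (R * R)%type R)
    : set (probability ((R * R) * (R * R))%type R) :=
  [set Pi | forall A : set (R * R), measurable A ->
     Pi (fst @^-1` A) = mu1 A /\ Pi (snd @^-1` A) = mu2 A].

Definition wasserstein (R : realType) (q : R)
    (mu1 mu2 : probability (R * R)%type R) : \bar R :=
  ereal_inf
    [set ((\int[Pi]_uv (euclid (colv (uv.1 - uv.2)) `^ q)%R%:E) `^ q^-1)%E
      | Pi in couplings mu1 mu2].

Definition expmx (R : realType) (A : 'M[R]_2) : 'M[R]_2 :=
  limn (series (fun k : nat => k`!%:R^-1 *: A ^+ k)).

Definition Qmx (R : realType) (gamma kappa : R) : 'M[R]_2 :=
  \matrix_(i < 2, j < 2)
    if i == 0 then (if j == 0 then 0 else -1)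
    else (if j == 0 then kappa else gamma).

Definition omega_set (R : realType) (gamma kappa : R) (z : R * R)
    : set 'cV[R]_2 :=
  cluster ((expR (gamma / 2 * t) *:
    (expmx (- t *: Qmx gamma kappa) *m colv z)) @[t --> +oo]).

(* Z eps z t is the state at time t of the system with noise intensity eps and
   initial value z. *)
Definition cutoff_thermalization_profile (R : realType) (d : measure_display)
    (Omega : measurableType d) (P : probability Omega R)
    (q gamma kappa : R) (Z : R -> R * R -> R -> {RV P >-> (R * R)%type})
    (mu : R -> probability (R * R)%type R) (z : R * R) : Prop :=
  let time (eps : R) := 2 / gamma * `|ln eps| in
  forall (weps : R -> R) (w : R), 0 < w ->
    weps eps @[eps --> 0^'+] --> w ->
    forall r : R, exists l : \bar R,
      (wasserstein q
         (distribution P (Z eps z (time eps + r * weps eps)%R)) (mu eps)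
       * (eps^-1)%:E)%E @[eps --> 0^'+] --> l /\
      forall v, omega_set gamma kappa z v ->
        l = (expR (- r * (gamma / 2) * w) * euclid v)%:E.

(* Main.v *)
(* With theta = sqrt(kappa - gamma^2/4) one has -Q = -(gamma/2) + theta J where
   J^2 = -1, so that e^{(gamma/2) t} e^{-Q t} z = cos(theta t) z + sin(theta t) J z
   is periodic and omega(z) is this whole ellipse. A profile would force the
   Euclidean norm to be constant on it; then J z is orthogonal to z and of the
   same length, so J is a rotation by a right angle, hence antisymmetric, which
   its diagonal entry gamma / (2 theta) > 0 forbids. *)
Require Import Defs.
From HB Require Import structures.
From mathcomp Require Import all_boot all_order all_algebra.
From mathcomp Require Import all_classical all_reals all_analysis.
From mathcomp Require Import ring lra.
Set Implicit Arguments.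
Unset Strict Implicit.
Unset Printing Implicit Defensive.
Import Order.TTheory GRing.Theory Num.Theory.
Import numFieldNormedType.Exports.
Local Open Scope classical_set_scope.
Local Open Scope ring_scope.

(** * Exponential generating functions *)

Definition egf_coeff (R : realType) (u : R^nat) : R^nat :=
  fun k => k`!%:R^-1 * u k.
(** Differentiation shifts the sequence [u], so a linear recurrence for [u] becomes a linear
    differential equation for [egf u]. *)
Definition egf (R : realType) (u : R^nat) (x : R) : R :=
  limn (pseries (egf_coeff u) x).

(** The terms are dominated by those of K e^{rho |x|}. *)
Lemma is_cvg_egf (R : realType) (u : R^nat) (K rho x : R) :
  0 <= rho -> (forall k, `|u k| <= K * rho ^+ k) ->
  cvgn (pseries (egf_coeff u) x).
Proof.
move=> rho0 uK.
have K0 : 0 <= K by have := le_trans (normr_ge0 _) (uK 0%N); rewrite expr0 mulr1.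
apply: normed_cvg.
apply: (@series_le_cvg _ _ (fun k => K * exp_coeff (rho * `|x|) k)) => [n|n|n|].
- exact: normr_ge0.
- by rewrite /= mulr_ge0// exp_coeff_ge0// mulr_ge0.
- rewrite [leRHS](_ : _ = n`!%:R^-1 * (K * rho ^+ n) * `|x| ^+ n); last first.
    by rewrite /exp_coeff/= exprMn; ring.
  rewrite /= /egf_coeff 2!normrM normrX ger0_norm ?invr_ge0//.
  by rewrite ler_wpM2r ?exprn_ge0// ler_wpM2l ?invr_ge0.
- apply: is_cvg_seriesZ; exact: is_cvg_series_exp_coeff.
Qed.

Lemma pseries_diffs_egf (R : realType) (u : R^nat) :
  pseries_diffs (egf_coeff u) = egf_coeff (fun k => u k.+1).
Proof.
apply/funext => k; rewrite /pseries_diffs /egf_coeff factS natrM invfM mulrA mulVKf//.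
Qed.

Lemma is_derive_egf (R : realType) (u : R^nat) (K rho x : R) :
  0 <= rho -> (forall k, `|u k| <= K * rho ^+ k) ->
  is_derive x (1 : R) (egf u) (egf (fun k => u k.+1) x).
Proof.
move=> rho0 uK; rewrite /egf -pseries_diffs_egf.
(* Termwise differentiation asks for convergence of the series and its first two derivatives at a
   point beyond |x|; shifting [u] only changes the constant [K]. *)
apply: (@pseries_snd_diffs _ _ (`|x| + 1)).
- exact: is_cvg_egf uK.
- rewrite pseries_diffs_egf; apply: (@is_cvg_egf _ _ (K * rho) rho) => // k.
  by rewrite -mulrA -exprS.
- rewrite !pseries_diffs_egf; apply: (@is_cvg_egf _ _ (K * rho ^+ 2) rho) => // k.
  by rewrite -mulrA -exprD.
by rewrite [ltRHS]ger0_norm// ltrDl.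
Qed.

Lemma egf0 (R : realType) (u : R^nat) : egf u 0 = u 0%N.
Proof.
apply/cvg_lim => //; rewrite -cvg_shiftS /=.
rewrite (_ : (fun n => _) = fun=> u 0%N); first exact: cvg_cst.
apply/funext => n; rewrite /pseries /series /= big_nat_recl//= big1 ?addr0.
  by rewrite /egf_coeff fact0 invr1 expr0 mul1r mulr1.
by move=> i _; rewrite exprS mul0r mulr0.
Qed.

(* Real and imaginary parts of (a + i b)^k. *)
Fixpoint cpow (R : realType) (a b : R) (k : nat) : R * R :=
  if k is k'.+1 then
    let u := cpow a b k' in (a * u.1 - b * u.2, b * u.1 + a * u.2)
  else (1, 0).

Lemma cpow_le (R : realType) (a b : R) k :
  `|(cpow a b k).1| <= 1 * (`|a| + `|b|) ^+ k /\
  `|(cpow a b k).2| <= 1 * (`|a| + `|b|) ^+ k.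
Proof.
elim: k => [|k [IH1 IH2]] /=; first by rewrite normr0 normr1 expr0 mulr1.
rewrite !mul1r in IH1 IH2 *; rewrite exprS mulrDl.
split; first by rewrite (le_trans (ler_normB _ _))// !normrM lerD// ler_wpM2l.
by rewrite (le_trans (ler_normD _ _))// !normrM addrC lerD// ler_wpM2l.
Qed.

Lemma egf_linear (R : realType) (u v : R^nat) (a b x : R) :
  cvgn (pseries (egf_coeff u) x) -> cvgn (pseries (egf_coeff v) x) ->
  egf (fun k => a * u k + b * v k) x = a * egf u x + b * egf v x.
Proof.
move=> cu cv; rewrite /egf; apply/cvg_lim => //.
have -> : pseries (egf_coeff (fun k => a * u k + b * v k)) x =
    (fun n => a * pseries (egf_coeff u) x n + b * pseries (egf_coeff v) x n).
  apply/funext => n; rewrite /pseries /series /= !mulr_sumr -big_split/=.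
  by apply: eq_bigr => i _; rewrite /egf_coeff; ring.
by apply: cvgD; apply: cvgMl_tmp.
Qed.

(** The recursion of [cpow] gives u' = a u - b v, v' = b u + a v with u(0) = 1, v(0) = 0, the system
    solved by the real and imaginary parts of e^{(a + i b) x}. *)
Lemma egf_cpow (R : realType) (a b x : R) :
  egf (fun k => (cpow a b k).1) x = expR (a * x) * cos (b * x) /\
  egf (fun k => (cpow a b k).2) x = expR (a * x) * sin (b * x).
Proof.
pose u := egf (fun k => (cpow a b k).1).
pose v := egf (fun k => (cpow a b k).2).
have rho0 : 0 <= `|a| + `|b| by rewrite addr_ge0.
have cu t := is_cvg_egf (x := t) rho0 (fun k => (cpow_le a b k).1).
have cv t := is_cvg_egf (x := t) rho0 (fun k => (cpow_le a b k).2).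
have du (t : R) : is_derive t (1 : R) u (a * u t - b * v t).
  rewrite -mulNr -egf_linear//.
  have := is_derive_egf t rho0 (fun k => (cpow_le a b k).1).
  rewrite (_ : (fun k => (cpow a b k.+1).1) =
    (fun k => a * (cpow a b k).1 + - b * (cpow a b k).2))//.
  by apply/funext => k /=; rewrite mulNr.
have dv (t : R) : is_derive t (1 : R) v (b * u t + a * v t).
  by rewrite -egf_linear//; exact: is_derive_egf t rho0 (fun k => (cpow_le a b k).2).
have u0 : u 0 = 1 by exact: egf0.
have v0 : v 0 = 0 by exact: egf0.
(* (p + i q)(t) = e^{-(a + i b) t} (u + i v)(t) is constant. *)
pose p t := expR (- a * t) * (cos (b * t) * u t + sin (b * t) * v t).
pose q t := expR (- a * t) * (cos (b * t) * v t - sin (b * t) * u t).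
have pE : p x = 1.
  have -> : p x = p 0.
    apply: is_derive_0_is_cst => t; rewrite /p.
    apply: trigger_derive.
    rewrite /GRing.scale /=. ring.
  by rewrite /p !mulr0 expR0 cos0 sin0 u0 v0; ring.
have qE : q x = 0.
  have -> : q x = q 0.
    apply: is_derive_0_is_cst => t; rewrite /q.
    apply: trigger_derive.
    rewrite /GRing.scale /=. ring.
  by rewrite /q !mulr0 expR0 cos0 sin0 u0 v0; ring.
have e1 := expRxMexpNx_1 (a * x).
have cs := cos2Dsin2 (b * x).
(* Inverts the definition of p + i q: the factors e^{a x} e^{-a x} and cos^2 + sin^2, both equal to
   1, are inserted on the left. *)
have key1 : u x = expR (a * x) * (p x * cos (b * x) - q x * sin (b * x)).
  rewrite /p /q mulNr -[LHS]mul1r -{1}e1 -[LHS]mul1r -{1}cs; ring.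
have key2 : v x = expR (a * x) * (p x * sin (b * x) + q x * cos (b * x)).
  rewrite /p /q mulNr -[LHS]mul1r -{1}e1 -[LHS]mul1r -{1}cs; ring.
by split; [rewrite -/u key1|rewrite -/v key2]; rewrite pE qE; ring.
Qed.

(** * Matrix exponential *)

(** J acts as the imaginary unit, so the powers follow the recursion of [cpow]. *)
Lemma expr_cpow (R : realType) (a b : R) (J : 'M[R]_2) k : J ^+ 2 = -1 ->
  (a *: 1 + b *: J) ^+ k = (cpow a b k).1 *: 1 + (cpow a b k).2 *: J.
Proof.
move=> J2; elim: k => [|k IHk]; first by rewrite expr0 scale1r scale0r addr0.
rewrite exprS IHk /= mulrDl !mulrDr -!scalerAl -!scalerAr !mul1r mulr1 -expr2 J2.
rewrite !scalerA !scalerN scalerBl scalerDl.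
by rewrite [X in _ + X = _]addrC addrACA [X in _ + X = _]addrC.
Qed.

Lemma expmx_rotation (R : realType) (a b : R) (J : 'M[R]_2) : J ^+ 2 = -1 ->
  expmx (a *: 1 + b *: J) = expR a *: (cos b *: 1 + sin b *: J).
Proof.
move=> J2; rewrite /expmx.
have rho0 : 0 <= `|a| + `|b| by rewrite addr_ge0.
have [E1 E2] := egf_cpow a b 1.
have cu : _ --> egf _ 1 := is_cvg_egf (x := 1) rho0 (fun k => (cpow_le a b k).1).
have cv : _ --> egf _ 1 := is_cvg_egf (x := 1) rho0 (fun k => (cpow_le a b k).2).
rewrite E1 !mulr1 in cu; rewrite E2 !mulr1 in cv.
apply/cvg_lim => //.
rewrite scalerDr !scalerA.
set s := series _.
have -> : s = (fun n => pseries (egf_coeff (fun k => (cpow a b k).1)) 1 n *: 1 +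
    pseries (egf_coeff (fun k => (cpow a b k).2)) 1 n *: J).
  apply/funext => n; rewrite /s /pseries /series /= !scaler_suml -big_split/=.
  apply: eq_bigr => i _.
  by rewrite expr_cpow// scalerDr !scalerA /egf_coeff !expr1n !mulr1.
by apply: cvgD; apply: cvgZr_tmp.
Qed.

(** * Accumulation points *)

(** A periodic function takes each of its values at arbitrarily late times. *)
Lemma cluster_periodic (R : realType) (V : topologicalType) (f : R -> V) (T t : R) :
  0 < T -> (forall s, f (s + T) = f s) -> cluster (f s @[s --> +oo]) (f t).
Proof.
move=> T0 fT A B [M [_ MA]] Bt.
exists (f t); split; last exact: nbhs_singleton.
have fTn n : f (t + T *+ n) = f t.
  by elim: n => [|n IHn]; rewrite ?mulr0n ?addr0// mulrSr addrA fT.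
(* Enough periods to carry [t] past the threshold [M]. *)
pose n := (Num.truncn (`|M - t| / T)).+1.
rewrite -(fTn n); apply: MA.
have : `|M - t| / T < n%:R by rewrite Num.Theory.truncnS_gt.
rewrite ltr_pdivrMr// mulr_natl -ltrBlDl; apply: le_lt_trans; exact: ler_norm.
Qed.

(* -Q = -(gamma/2) + theta J, where J^2 = -1 if theta^2 = kappa - gamma^2/4. *)
Definition Jmx (R : realType) (gamma kappa theta : R) : 'M[R]_2 :=
  theta^-1 *: ((gamma / 2) *: 1 - Qmx gamma kappa).

(** This is Cayley-Hamilton, Q^2 - gamma Q + kappa = 0, after completing the square; it is checked
    entry by entry. *)
Lemma sqr_Jmx (R : realType) (gamma kappa theta : R) : theta != 0 ->
  theta ^+ 2 = kappa - gamma ^+ 2 / 4 ->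
  Jmx gamma kappa theta ^+ 2 = -1.
Proof.
move=> t0 t2.
apply/matrixP => i j; rewrite expr2 mxE !big_ord_recl big_ord0 !mxE/=.
have K : kappa = theta ^+ 2 + gamma ^+ 2 / 4 by lra.
rewrite K.
case: i => [[|[|i]] //= Hi]; case: j => [[|[|j]] //= Hj]; rewrite /=; field => //.
Qed.

Lemma scale_Qmx (R : realType) (gamma kappa theta t : R) : theta != 0 ->
  - t *: Qmx gamma kappa =
  (- (gamma / 2 * t)) *: 1 + (theta * t) *: Jmx gamma kappa theta.
Proof.
move=> t0; rewrite /Jmx scalerA [theta * t / _]mulrAC mulfV// mul1r scalerBr scalerA addrA.
by rewrite -scalerDl [t * _]mulrC addNr scale0r add0r scaleNr.
Qed.

(** The scalar factor cancels the decay of e^{-Q t}; what is left has period 2 pi / theta and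
    reaches the phase [phi] at time [phi / theta]. *)
Lemma omega_set_rotation (R : realType) (gamma kappa theta phi : R) (z : R * R) :
  0 < theta -> theta ^+ 2 = kappa - gamma ^+ 2 / 4 ->
  omega_set gamma kappa z
    (cos phi *: colv z + sin phi *: (Jmx gamma kappa theta *m colv z)).
Proof.
move=> t0 t2; rewrite /omega_set.
have tn0 : theta != 0 by rewrite gt_eqF.
pose f t := cos (theta * t) *: colv z +
  sin (theta * t) *: (Jmx gamma kappa theta *m colv z).
rewrite (_ : (fun t => _) = f); last first.
  apply/funext => t; rewrite (@scale_Qmx _ _ _ theta)// expmx_rotation ?sqr_Jmx//.
  rewrite -scalemxAl scalerA mulrC.
  by rewrite expRN mulVf ?expR_eq0// scale1r mulmxDl -2!scalemxAl mul1mx.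
rewrite (_ : _ + _ = f (phi / theta)); last by rewrite /f mulrCA mulfV// mulr1.
apply: (@cluster_periodic _ _ _ (pi *+ 2 / theta)).
  by rewrite divr_gt0// pmulrn_lgt0// pi_gt0.
by move=> s; rewrite /f mulrDr mulrCA mulfV// mulr1 cosD2pi sinD2pi.
Qed.

(** * Constant norm on the ellipse *)

Lemma euclid_rotation_nonconstant (R : realType) (gamma kappa theta : R)
    (z : R * R) (N : R) :
  0 < gamma -> 0 < theta -> theta ^+ 2 = kappa - gamma ^+ 2 / 4 ->
  (forall phi, euclid (cos phi *: colv z
     + sin phi *: (Jmx gamma kappa theta *m colv z)) = N) ->
  z = (0, 0).
Proof.
move=> g0 t0 t2 H.
have tn0 : theta != 0 by rewrite gt_eqF.
pose x := z.1; pose y := z.2.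
(* The vector (u, v) is J z. *)
pose u := (gamma / 2 * x + y) / theta; pose v := (- kappa * x - gamma / 2 * y) / theta.
have E phi : (cos phi * x + sin phi * u) ^+ 2 + (cos phi * y + sin phi * v) ^+ 2 = N ^+ 2.
  rewrite -(H phi) sqr_sqrtr; last by apply: sumr_ge0 => i _; rewrite sqr_ge0.
  rewrite /u /v !big_ord_recl big_ord0 !mxE !big_ord_recl !big_ord0 !mxE/=.
  rewrite -/x -/y; field => //.
(* Phases 0 and pi/2 give |z| = |J z|; phase pi/4, where sine and cosine are both nonzero, isolates
   the inner product of z and J z. *)
have E1 := E 0; have E2 := E (pi / 2); have E3 := E (pi / 4).
rewrite cos0 sin0 in E1; rewrite cos_pihalf sin_pihalf in E2.
have pi0 := pi_gt0 R.
have c0 : 0 < cos (pi / 4 : R) by rewrite cos_gt0_pihalf//; lra.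
have s0 : 0 < sin (pi / 4 : R) by rewrite sin_gt0_pihalf//; lra.
have cs := cos2Dsin2 (pi / 4 : R).
move: (cos _) (sin _) => c s in c0 s0 cs E3.
have F1 : u ^+ 2 + v ^+ 2 = x ^+ 2 + y ^+ 2 by nra.
have F2 : x * u + y * v = 0.
  have : 2 * (c * s) * (x * u + y * v) = 0.
    have -> : 2 * (c * s) * (x * u + y * v) = ((c * x + s * u) ^+ 2 + (c * y + s * v) ^+ 2)
      - (c ^+ 2 * (x ^+ 2 + y ^+ 2) + s ^+ 2 * (u ^+ 2 + v ^+ 2)) by ring.
    rewrite F1 -mulrDl cs E3 -E1; ring.
  by move/eqP; rewrite mulf_eq0 gt_eqF ?mulr_gt0// => /eqP.
pose r := x ^+ 2 + y ^+ 2.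
pose D := kappa * x ^+ 2 + gamma * x * y + y ^+ 2.
have F3 : D = theta * (u * y - v * x) by rewrite /D /u /v; field.
(* By [F3], D is theta times the determinant of (J z, z), whose square Lagrange's identity gives
   from lengths and inner product. *)
have D2 : D ^+ 2 = theta ^+ 2 * r ^+ 2.
  rewrite F3 exprMn; congr (_ * _).
  transitivity (r * (u ^+ 2 + v ^+ 2) - (x * u + y * v) ^+ 2); first by rewrite /r; ring.
  by rewrite F1 F2 -/r; ring.
have F5 : gamma * (x ^+ 2 - y ^+ 2) = (kappa - 1) * (2 * x * y).
  apply/eqP; rewrite -subr_eq0; apply/eqP.
  transitivity (2 * theta * (x * u + y * v)); last by rewrite F2 mulr0.
  by rewrite /u /v; field.
(* The left base is (kappa - 1)(x^2 - y^2) + gamma (2 x y). The two-square identity for (kappa - 1,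
   gamma) and (x^2 - y^2, 2 x y) applies, and its other square vanishes by [F5]. *)
have F6 : (2 * D - (kappa + 1) * r) ^+ 2 =
    ((kappa - 1) ^+ 2 + gamma ^+ 2) * r ^+ 2.
  transitivity (((kappa - 1) ^+ 2 + gamma ^+ 2) * r ^+ 2 -
    (gamma * (x ^+ 2 - y ^+ 2) - (kappa - 1) * (2 * x * y)) ^+ 2).
    by rewrite /D /r; ring.
  by rewrite F5 subrr expr0n subr0.
(* If r <> 0, then D2 and F6 force 4 theta^2 = (kappa + 1)^2, that is,
   (kappa - 1)^2 + gamma^2 = 0. *)
have [r0|rn0] := eqVneq r 0.
  have x0 : x = 0 by apply/eqP; rewrite -sqrf_eq0; rewrite /r in r0; nra.
  have y0 : y = 0 by apply/eqP; rewrite -sqrf_eq0; rewrite /r in r0; nra.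
  by rewrite [z]surjective_pairing -/x -/y x0 y0.
exfalso.
(* Expand [F6], substitute [D2] and 4 theta^2 = 4 kappa - gamma^2, and cancel one factor r. *)
have F7 : D * (kappa + 1) = 2 * theta ^+ 2 * r.
  apply: (mulIf rn0); nra.
have F8 : (kappa + 1) ^+ 2 = 4 * theta ^+ 2.
  have n0 : theta ^+ 2 * r ^+ 2 != 0 by rewrite mulf_neq0 ?expf_neq0.
  apply: (mulIf n0); rewrite -{1}D2 mulrC -exprMn F7; ring.
have := sqr_ge0 (kappa - 1); have : 0 < gamma ^+ 2 by rewrite exprn_gt0.
nra.
Qed.

Theorem lemma4p2 (R : realType) (d : measure_display)
    (Omega : measurableType d) (P : probability Omega R)
    (p q : R) (hq : 1 <= q) (hqp : q <= p)
    (L : R -> {RV P >-> R}) (nu : {measure set R -> \bar R})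
    (hL : levy_process L) (hnu : levy_measure_of L nu)
    (hmom : (\int[nu]_(z in [set z : R | (1 < `|z|)%R]) (`|z| `^ p)%R%:E
             < +oo)%E)
    (gamma kappa : R) (hgamma : 0 < gamma) (hkappa : 0 < kappa)
    (hsub : gamma ^+ 2 - 4 * kappa < 0)
    (Z : R -> R * R -> R -> {RV P >-> (R * R)%type})
    (hZ : forall (eps : R) (z : R * R), 0 < eps ->
       oscillator_solution L gamma kappa eps z (Z eps z))
    (mu : R -> probability (R * R)%type R)
    (hmu : forall (eps : R) (z : R * R), 0 < eps ->
       limiting_distribution (Z eps z) (mu eps))
    (z : R * R) (hz : z <> (0, 0)) :
  ~ cutoff_thermalization_profile q gamma kappa Z mu z.
Proof.
(* With window 1 and r = 0 the exponential factor is 1, so all points of omega(z) have the same norm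
   [fine l]. *)
move=> /(_ (fun=> 1) 1 ltr01 (cvg_cst _) 0)[l [_ lE]].
pose theta := Num.sqrt (kappa - gamma ^+ 2 / 4).
have k0 : 0 < kappa - gamma ^+ 2 / 4 by lra.
have t0 : 0 < theta by rewrite sqrtr_gt0.
have t2 : theta ^+ 2 = kappa - gamma ^+ 2 / 4 by rewrite sqr_sqrtr// ltW.
apply: hz; apply: (@euclid_rotation_nonconstant _ gamma kappa theta z (fine l)) => //.
move=> phi; have := lE _ (omega_set_rotation (phi := phi) (z := z) t0 t2).
by rewrite oppr0 !mul0r expR0 mul1r => ->.
Qed.
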